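(* Let $A>0$ and let $\mu$ be a product measure $$\mu=\prod_{i=1}^{d}e^{W_i}\,dx_i$$ with convex potentials $W_i=W_i(x_i)$ such that, for every $i$, $$W_i''e^{-2W_i}\ge A^2,\qquad W_i \text{ is even and } W_i(0)=0.$$ Then $$\mathcal{I}_{\mu}\ge\mathcal{I}_{\mu_A},$$ where $\mu_A=\prod_{i=1}^{d}\frac{dx_i}{\cos Ax_i}$ is the measure on $[-\frac{\pi}{2A},\frac{\pi}{2A}]^d$.
   Context: For a Borel measure $\mu$ and a Borel set $B$, the surface measure is $\mu^{+}(\partial B)=\liminf_{\varepsilon\to 0}\frac{\mu(B^\varepsilon)-\mu(B)}{\varepsilon}$, where $B^\varepsilon$ is the $\varepsilon$-neighborhood of $B$. The isoperimetric function of $\mu$ is $\mathcal{I}_\mu(t)=\inf_B\{\mu^{+}(\partial B):\mu(B)=t\}$. The potentials $W_i$ are convex functions on $\mathbb{R}$ allowed to take the value $+\infty$ (with $e^{+\infty}=+\infty$), so that, as for $\mu_A$, each $W_i$ may be finite only on a bounded interval symmetric about $0$; the differential inequality is required where $W_i$ is finite. *)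

(* Defs.v *)
From HB Require Import structures.
From mathcomp Require Import all_boot all_order all_algebra.
From mathcomp Require Import all_classical all_reals all_analysis.
Import Order.TTheory GRing.Theory Num.Theory.
Import numFieldNormedType.Exports.

Set Implicit Arguments.
Unset Strict Implicit.
Unset Printing Implicit Defensive.

Local Open Scope classical_set_scope.
Local Open Scope ring_scope.

(* The library equips tuples with the product sigma-algebra; for real tuples
   this is the Borel sigma-algebra of R^d. *)
Notation Rspace R d := (d.-tuple (measurableTypeR R)).

Definition Rcons (R : realType) n (p : measurableTypeR R * Rspace R n) :
    Rspace R n.+1 :=
  [the n.+1.-tuple (measurableTypeR R) of p.1 :: p.2].

Lemma measurable_Rcons (R : realType) n :
  measurable_fun [set: _] (@Rcons R n).
Proof. exact: measurable_cons. Qed.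

Definition lebesgue_cons (R : realType) n
    (m : {sigma_finite_measure set (Rspace R n) -> \bar R}) :
    set (Rspace R n.+1) -> \bar R :=
  pushforward (@lebesgue_measure R \x m)%E (@Rcons R n).

Section lebesgue_cons_measure.
Variables (R : realType) (n : nat).
Variable m : {sigma_finite_measure set (Rspace R n) -> \bar R}.
Local Open Scope ereal_scope.

Let P : {measure set (Rspace R n.+1) -> \bar R} :=
  @measure_function_pushforward__canonical__measure_function_Measure
    _ _ _ _ _ (@lebesgue_measure R \x m) _ (@measurable_Rcons R n).

Let lebesgue_cons0 : lebesgue_cons m set0 = 0.
Proof. exact: (measure0 P). Qed.

Let lebesgue_cons_ge0 A : 0 <= lebesgue_cons m A.
Proof. exact: (measure_ge0 P). Qed.

Let lebesgue_cons_sigma_additive : semi_sigma_additive (lebesgue_cons m).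
Proof. exact: (@measure_semi_sigma_additive _ _ _ P). Qed.

HB.instance Definition _ := isMeasure.Build _ _ _ (lebesgue_cons m)
  lebesgue_cons0 lebesgue_cons_ge0 lebesgue_cons_sigma_additive.

Let lebesgue_cons_sigma_finite : sigma_finite setT (lebesgue_cons m).
Proof.
have /sigma_finiteP[F [FT ndF Foo]] := sigma_finiteT (@lebesgue_measure R).
have /sigma_finiteP[G [GT ndG Goo]] := sigma_finiteT m.
pose g (t : Rspace R n.+1) : measurableTypeR R * Rspace R n :=
  (tnth t ord0, [tuple of behead t]).
have mg : measurable_fun [set: _] g.
  apply/measurable_fun_pair; first exact: measurable_tnth.
  exact: measurable_behead.
have gK : cancel (@Rcons R n) g.
  by case=> x t; rewrite /g /Rcons; congr pair; exact/val_inj.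
have FGT : \bigcup_k (F k `*` G k) = setT.
  rewrite -setXTT FT GT; apply/seteqP; split=> [[x y] [k _ [Fx Gy]]|[x y]].
    by split; exists k.
  move=> [/= [i _ Fix] [k _ Gky]]; exists (maxn i k) => //; split.
    by move: x Fix; exact/subsetPset/ndF/leq_maxl.
  by move: y Gky; exact/subsetPset/ndG/leq_maxr.
exists (fun k => g @^-1` (F k `*` G k)).
  by rewrite -preimage_bigcup FGT preimage_setT.
move=> k; have [mF Fk] := Foo k; have [mG Gk] := Goo k; split.
  by rewrite -[X in measurable X]setTI; apply: mg => //; exact: measurableX.
rewrite /lebesgue_cons /pushforward -comp_preimage.
rewrite (_ : _ \o _ = id); last by apply/funext => p; exact: gK.
by rewrite preimage_id product_measure1E// lte_mul_pinfty// ge0_fin_numE.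
Qed.

HB.instance Definition _ := @Measure_isSigmaFinite.Build _ _ _
  (lebesgue_cons m) lebesgue_cons_sigma_finite.

End lebesgue_cons_measure.

Fixpoint lebesgue_Rspace (R : realType) d :
    {sigma_finite_measure set (Rspace R d) -> \bar R} :=
  match d with
  | 0 => @dirac _ (Rspace R 0) [tuple] R
  | n.+1 => lebesgue_cons (lebesgue_Rspace R n)
  end.

Lemma lebesgue_Rspace_box (R : realType) d
    (A : 'I_d -> set (measurableTypeR R)) :
  (forall i, measurable (A i)) ->
  lebesgue_Rspace R d [set x | forall i, A i (tnth x i)] =
  (\prod_(i < d) @lebesgue_measure R (A i))%E.
Proof.
elim: d A => [|n IH] A mA.
  by rewrite big_ord0 /= diracE mem_set//= => -[].
rewrite big_ord_recl -IH// /= /lebesgue_cons /pushforward.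
rewrite -product_measure1E//; last first.
  rewrite [X in measurable X](_ : _ = \big[setI/setT]_(i < n)
     ((@tnth n (measurableTypeR R))^~ i @^-1` A (lift ord0 i))).
    apply: bigsetI_measurable => i _.
    by rewrite -[X in measurable X]setTI; exact: measurable_tnth.
  apply/seteqP; split=> [x /= xA|x].
    by rewrite -bigcap_seq => i _; exact: xA.
  by rewrite -bigcap_seq => + i; apply; rewrite /= mem_index_enum.
congr (_ _); apply/seteqP; split=> [[x t] /= xA|[x t] [/= x0 tA] i].
  split => /= [|i]; first exact: (xA ord0).
  by have := xA (lift ord0 i); rewrite tnthS.
by have [j ->|->] := unliftP ord0 i; rewrite ?tnthS.
Qed.

(* Euclidean distance; the norm the library puts on vectors is the sup norm. *)
Definition edist (R : realType) d (x y : Rspace R d) : R :=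
  Num.sqrt (\sum_(i < d) ((tnth x i : R) - (tnth y i : R)) ^+ 2).

Definition eneigh (R : realType) d (e : R) (B : set (Rspace R d)) :
    set (Rspace R d) :=
  [set x | exists2 y, B y & edist x y < e].

Definition surface_measure (R : realType) d
    (mu : set (Rspace R d) -> \bar R) (B : set (Rspace R d)) : \bar R :=
  limf_einf (fun e : R => (mu (eneigh e B) - mu B) * (e^-1)%:E)%E 0^'+.

Definition isoperimetric_function (R : realType) d
    (mu : set (Rspace R d) -> \bar R) (t : R) : \bar R :=
  ereal_inf [set surface_measure mu B | B in
    [set B | measurable B /\ mu B = t%:E]].

(* prod_i e^(W_i) dx_i, with the convention e^(+oo) = +oo of expeR: the density
   is +oo, not 0, where some W_i is +oo.  The one-dimensional factors are then
   not sigma-finite, so the product is given by its density with respect to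
   Lebesgue measure rather than by the library's product of measures. *)
Definition potential_measure (R : realType) d (W : 'I_d -> R -> \bar R)
    (B : set (Rspace R d)) : \bar R :=
  (\int[lebesgue_Rspace R d]_(x in B) \prod_(i < d) expeR (W i (tnth x i)))%E.

(* the values on the faces of the cube, where cos vanishes, are irrelevant:
   the faces are Lebesgue-null *)
Definition secant_measure (R : realType) d (A : R) (B : set (Rspace R d)) :
    \bar R :=
  (\int[lebesgue_Rspace R d]_(x in B `&`
      [set x | forall i, - (pi / (2 * A)) <= (tnth x i : R) <= pi / (2 * A)]%R)
    (\prod_(i < d) (cos (A * (tnth x i : R)))^-1)%R%:E)%E.

(* 0 * +oo = 0 in \bar R, so that t = 0 and t = 1 impose nothing *)
Definition econvex (R : realType) (W : R -> \bar R) : Prop :=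
  forall x y t : R, 0 <= t <= 1 ->
    (W (t * x + (1 - t) * y)%R <= t%:E * W x + (1 - t)%:E * W y)%E.

(* Main.v *)
Require Import Defs.
From HB Require Import structures.
From mathcomp Require Import all_boot all_order all_algebra.
From mathcomp Require Import all_classical all_reals all_analysis.
From mathcomp Require Import measurable_realfun ring lra.
Import Order.TTheory GRing.Theory Num.Theory.
Import numFieldNormedType.Exports.

Set Implicit Arguments.
Unset Strict Implicit.
Unset Printing Implicit Defensive.

Local Open Scope classical_set_scope.
Local Open Scope ring_scope.

(** The measure mu_A is the extremal case: for W = - ln cos (A x) the
    differential inequality is an equality.  The proof transports mu to mu_A
    by a map that is the product of one-dimensional monotone maps, and shows
    that its inverse does not increase distances.

    In one variable let ]-a, a[ be the interior of the domain of W, let F be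
    the primitive of exp W with F 0 = 0, and let T x = gud A (F x), where gud A
    inverts the primitive of 1 / cos (A x).  By construction T maps exp W dx on
    ]-a, a[ to dx / cos (A x) on the image of T, and
    T' = exp W / cosh (A F).  So T expands distances as soon as
    cosh (A F) <= exp W (cosh_le_expR).  In the variable s = F x the function
    p = exp W satisfies p'' >= A ^ 2 p, p (0) = 1, p' (0) = 0, which is the
    usual comparison with cosh (A s).  The expanding map T has a left inverse
    S on the whole line that is 1-Lipschitz and takes boundary values +-a
    outside the image of T (clamped_inverse); it carries mu_A, restricted to
    the points sent into ]-a, a[, to exp W dx (exists_secant_transport).

    In dimension n apply such maps S in every coordinate.  Tonelli turns the
    one-dimensional change of variables into an n-dimensional one
    (integral_coordinatewise), and the product map is 1-Lipschitz for the
    Euclidean distance.  Given B with mu B = t finite, the density of mu being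
    +oo outside the closed box, almost all of B lies in the open box D, so the
    preimage B' of B `&` D has mu_A B' = t.  A point of the e-neighbourhood of B'
    is sent to the e-neighbourhood C of B `&` D.  If C is contained in D this
    gives mu_A (B'^e) <= mu C <= mu (B^e); otherwise the open set C charges the
    complement of the closed box, hence mu (B^e) = +oo and nothing is left to
    prove.  Comparing the difference quotients of B' and B and taking infima
    yields the theorem. *)

(** * Calculus on the line *)

Section pointwise_derivatives.
Variable R : realType.
Implicit Types (f g : R -> R) (x df dg k : R).

(** These rules restate the ones for pointwise operations on functions for
    explicit abstractions, the form in which the derivatives below arise. *)
Lemma is_derive_mul f g x df dg : is_derive x 1 f df -> is_derive x 1 g dg ->
  is_derive x 1 (fun y => f y * g y) (df * g x + f x * dg).
Proof.
move=> Hf Hg; apply: (@is_derive_eq _ _ _ (f * g)).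
by rewrite /GRing.scale/= addrC mulrC.
Qed.

Lemma is_derive_mull k f x df : is_derive x 1 f df ->
  is_derive x 1 (fun y => k * f y) (k * df).
Proof. by move=> Hf; apply: (@is_derive_eq _ _ _ (k *: f)). Qed.

Lemma is_derive_add f g x df dg : is_derive x 1 f df -> is_derive x 1 g dg ->
  is_derive x 1 (fun y => f y + g y) (df + dg).
Proof. by move=> Hf Hg; apply: (@is_derive_eq _ _ _ (f + g)). Qed.

Lemma is_derive_sub f g x df dg : is_derive x 1 f df -> is_derive x 1 g dg ->
  is_derive x 1 (fun y => f y - g y) (df - dg).
Proof. by move=> Hf Hg; apply: (@is_derive_eq _ _ _ (f - g)). Qed.

Lemma is_derive_comp f g x df dg :
  is_derive (g x) 1 f df -> is_derive x 1 g dg ->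
  is_derive x 1 (fun y => f (g y)) (df * dg).
Proof. by move=> Hf Hg; apply: (@is_derive_eq _ _ _ (f \o g)). Qed.

Lemma is_derive_continuous f x df : is_derive x 1 f df -> {for x, continuous f}.
Proof. by move=> [dfx _]; apply: differentiable_continuous; exact/derivable1_diffP. Qed.

Lemma mean_value f (df : R -> R) x y : x <= y ->
  (forall z, x <= z <= y -> is_derive z 1 f (df z)) ->
  exists2 z, x <= z <= y & f y - f x = df z * (y - x).
Proof.
move=> xy dfz; have [||z] := @MVT_segment R f df x y xy.
- by move=> z; rewrite in_itv/= => /andP[xz zy]; apply: dfz; rewrite !ltW.
- apply: derivable_within_continuous => z; rewrite in_itv/= => xzy.
  by have [] := dfz _ xzy.
by rewrite in_itv/=; exists z.
Qed.

Lemma derive_ge0_le f (df : R -> R) x y : x <= y ->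
  (forall z, x <= z <= y -> is_derive z 1 f (df z)) ->
  (forall z, x <= z <= y -> 0 <= df z) -> f x <= f y.
Proof.
move=> xy dfz df0; have [z zxy fxy] := mean_value xy dfz.
by rewrite -subr_ge0 fxy mulr_ge0 ?df0// subr_ge0.
Qed.

End pointwise_derivatives.

Section antiderivatives.
Variable R : realType.
Notation mu := (@lebesgue_measure R).

Lemma integral_derive (F f : R -> R) (x y : R) : x < y ->
  (forall z, x <= z <= y -> is_derive z 1 F (f z)) ->
  (forall z, x <= z <= y -> {for z, continuous f}) ->
  (\int[mu]_(z in `]x, y]) (f z)%:E = (F y - F x)%:E)%E.
Proof.
move=> xy dF cf; have cF z : x <= z <= y -> {for z, continuous F}.
  by move=> /dF; exact: is_derive_continuous.
have cfxy : {within `[x, y], continuous f}.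
  by apply: continuous_in_subspaceT => z; rewrite inE/= in_itv/=; exact: cf.
rewrite integral_itv_obnd_cbnd; last first.
  apply/measurable_EFinP; apply: (@measurable_funS _ _ _ _ `[x, y]%classic) => //.
    exact: subset_itv_oc_cc.
  exact: subspace_continuous_measurable_fun.
rewrite (@continuous_FTC2 _ f F) ?EFinB//.
- split.
  + by move=> z; rewrite in_itv/= => /andP[? ?]; have [] := dF z; rewrite ?ltW.
  + by apply: cvg_at_right_filter; apply: cF; rewrite lexx ltW.
  + by apply: cvg_at_left_filter; apply: cF; rewrite lexx ltW.
- move=> z; rewrite in_itv/= => /andP[? ?]; rewrite derive1E.
  by have [] := dF z; rewrite ?ltW.
Qed.

(** The primitive has to be global on ]-a, a[ although u may fail to be
    integrable near the end points, so it is an oriented integral from 0. *)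
Lemma exists_antiderivative (u : R -> R) (a : R) :
  (forall x, `|x| < a -> {for x, continuous u}) ->
  exists F : R -> R, F 0 = 0 /\ forall x : R, `|x| < a -> is_derive x 1 F (u x).
Proof.
move=> cu; pose P b x := (\int[mu]_(t in `[- b, x]) u t)%R.
pose F x := if 0 <= x then (\int[mu]_(t in `]0, x]) u t)%R
            else - (\int[mu]_(t in `]x, 0]) u t)%R.
have iu b : b < a -> mu.-integrable `[- b, b] (EFin \o u).
  move=> ba; apply: continuous_compact_integrable; first exact: segment_compact.
  apply: continuous_in_subspaceT => z; rewrite inE/= in_itv/= -ler_norml => zb.
  by apply: cu; exact: le_lt_trans ba.
(* on [-b, b] the primitive differs by a constant from an integral with a fixed
   lower end point, to which the fundamental theorem applies *)
have FP b x : b < a -> `|x| < b -> F x = P b x - P b 0.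
  move=> ba xb; have b0 : 0 < b by rewrite (le_lt_trans _ xb).
  move: xb; rewrite ltr_norml => /andP[bx xb].
  have ibx z : - b <= z <= b -> mu.-integrable `[- b, z] (EFin \o u).
    move=> /andP[bz zb]; apply: integrableS (iu _ ba) => //.
    by apply: subset_itvl; rewrite bnd_simp.
  rewrite /F /P; case: ifPn => [x0|]; last rewrite -ltNge => x0.
    by rewrite Rintegral_itvB ?bnd_simp//; [apply: ibx; lra|lra].
  rewrite -[in RHS]opprB; congr (- _).
  by rewrite Rintegral_itvB ?bnd_simp//; [apply: ibx; lra|lra|lra].
exists F; split.
  by rewrite /F lexx set_itv_ge ?bnd_simp ?ltxx// Rintegral_set0.
move=> x xa; pose b := (`|x| + a) / 2.
have [xb ba] : `|x| < b /\ b < a by rewrite /b; split; lra.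
move: (xb); rewrite ltr_norml => /andP[bx xb'].
have [dP P'] := continuous_FTC1_closed xb' (iu _ ba) bx (cu _ xa).
apply: (@near_eq_is_derive _ _ _ (fun y => P b y - P b 0)).
  near=> y; apply/esym/FP => //; near: y.
  exact: (@cvgr_norm_lt R R^o R (nbhs x) _ id x cvg_id b xb).
have dPx : is_derive x 1 (P b) (u x).
  by apply: DeriveDef; [exact: dP|rewrite -derive1E].
by have := is_derive_sub dPx (is_derive_cst (P b 0) x 1); rewrite subr0.
Unshelve. all: by end_near. Qed.

(** The inverse Gudermannian function, rescaled. *)
Definition secant_primitive (A x : R) : R := A^-1 * ln (tan (A / 2 * x + pi / 4)).

Let scaled_norm_lt (A x : R) : 0 < A -> `|x| < pi / (2 * A) -> `|A * x| < pi / 2.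
Proof.
move=> A0 xc; rewrite normrM gtr0_norm// mulrC -ltr_pdivlMr//.
by rewrite (lt_le_trans xc)// invfM mulrA.
Qed.

Lemma cos_scaled_gt0 (A x : R) : 0 < A -> `|x| < pi / (2 * A) -> 0 < cos (A * x).
Proof. by move=> A0 /(scaled_norm_lt A0); rewrite ltr_norml; exact: cos_gt0_pihalf. Qed.

Lemma is_derive_secant_primitive (A x : R) : 0 < A -> `|x| < pi / (2 * A) ->
  is_derive x 1 (secant_primitive A) (cos (A * x))^-1.
Proof.
move=> A0 xc; pose t := A / 2 * x + pi / 4.
have [t0 t1] : 0 < t /\ t < pi / 2.
  have := scaled_norm_lt A0 xc; rewrite ltr_norml /t => /andP[? ?].
  by split; lra.
have pi0 := pi_gt0 R.
have sint : 0 < sin t by apply: sin_gt0_pi; apply/andP; split; lra.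
have cost : 0 < cos t by apply: cos_gt0_pihalf; apply/andP; split; lra.
have tant : 0 < tan t by rewrite /tan divr_gt0.
have dt : is_derive x 1 (fun y : R => A / 2 * y + pi / 4) (A / 2 * 1 + 0).
  exact: is_derive_add (is_derive_mull (A / 2) (is_derive_id _ _)) (is_derive_cst _ _ _).
have dtan := is_derive_comp (f := tan) (g := fun y => A / 2 * y + pi / 4)
  (is_derive_tan (lt0r_neq0 cost)) dt.
have dln := is_derive_comp (f := @ln R) (g := fun y => tan (A / 2 * y + pi / 4))
  (is_derive1_ln tant) dtan.
have := is_derive_mull A^-1 dln; congr is_derive.
(* A x = 2 t - pi / 2 *)
have -> : cos (A * x) = 2 * (sin t * cos t).
  have -> : A * x = t *+ 2 - pi / 2 by rewrite /t; field.
  by rewrite cosBpihalf sin_mulr2n mulr2n; ring.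
rewrite -/t /tan; field.
by rewrite !lt0r_neq0.
Qed.

Lemma continuous_secant_inv (A x : R) : 0 < A -> `|x| < pi / (2 * A) ->
  {for x, continuous (fun y => (cos (A * y))^-1)}.
Proof.
move=> A0 xc.
have cosx : cos (A * x) != 0 by apply: lt0r_neq0; exact: cos_scaled_gt0.
apply: (@cvgV _ _ _ _ (fun y => cos (A * y))) => //.
apply: (@continuous_comp _ _ _ (fun y => A * y) cos); last exact: continuous_cos.
exact: mulrl_continuous.
Qed.

(** The Gudermannian function, rescaled so that its derivative is
    1 / cosh (A s). *)
Definition gud (A s : R) : R := 2 / A * (atan (expR (A * s)) - pi / 4).

Lemma gud_bound (A s : R) : 0 < A -> `|gud A s| < pi / (2 * A).
Proof.
move=> A0; rewrite /gud normrM gtr0_norm ?divr_gt0//.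
rewrite -ltr_pdivlMl ?divr_gt0//.
have -> : (2 / A)^-1 * (pi / (2 * A)) = pi / 4 by field; exact: lt0r_neq0.
rewrite ltr_norml; apply/andP; split.
  by rewrite ltrBrDr addrC subrr -(atan0 R) lt_atan// expR_gt0.
by have := atan_ltpi2 (expR (A * s)); lra.
Qed.

Lemma gudK (A s : R) : 0 < A -> secant_primitive A (gud A s) = s.
Proof.
move=> A0; rewrite /secant_primitive /gud.
have -> : A / 2 * (2 / A * (atan (expR (A * s)) - pi / 4)) + pi / 4 =
  atan (expR (A * s)) by field; exact: lt0r_neq0.
by rewrite atanK expRK mulKf//; exact: lt0r_neq0.
Qed.

Lemma is_derive_gud (A s : R) : 0 < A ->
  is_derive s 1 (gud A) (2 / (expR (A * s) + expR (- A * s))).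
Proof.
move=> A0.
have de : is_derive s 1 (fun t : R => expR (A * t)) (expR (A * s) * (A * 1)).
  by apply: (is_derive_comp (f := expR) (g := fun t => A * t)) (is_derive_expR _) _.
have datan := is_derive_comp (f := @atan R) (g := fun t => expR (A * t))
  (is_derive1_atan _) de.
have := is_derive_mull (2 / A) (is_derive_sub datan (is_derive_cst (pi / 4) s 1)).
congr is_derive.
rewrite mulNr expRN; set e := expR _; have e0 : 0 < e by exact: expR_gt0.
by field; rewrite !lt0r_neq0// addr_gt0// ?exprn_gt0// mulr_gt0.
Qed.

End antiderivatives.

(** * The comparison with the hyperbolic cosine *)

Section cosh_comparison.
Variables (R : realType) (A a : R) (w w1 w2 F : R -> R).
Hypothesis dw : forall x : R, `|x| < a -> is_derive x 1 w (w1 x).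
Hypothesis dw1 : forall x : R, `|x| < a -> is_derive x 1 w1 (w2 x).
Hypothesis dF : forall x : R, `|x| < a -> is_derive x 1 F (expR (w x)).
Hypothesis w2_ge : forall x : R, `|x| < a -> A ^+ 2 <= w2 x * expR (- 2 * w x).
Hypotheses (w00 : w 0 = 0) (w10 : w1 0 = 0) (F0 : F 0 = 0).

Let e x := expR (A * F x).
Let e' x := expR (- A * F x).

Let de (x : R) : `|x| < a -> is_derive x 1 e (A * expR (w x) * e x).
Proof.
move=> xa; rewrite [X in is_derive _ _ _ X]mulrC.
exact: is_derive_comp (is_derive_mull A (dF xa)).
Qed.

Let de' (x : R) : `|x| < a -> is_derive x 1 e' (- A * expR (w x) * e' x).
Proof.
move=> xa; rewrite [X in is_derive _ _ _ X]mulrC.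
exact: is_derive_comp (is_derive_mull (- A) (dF xa)).
Qed.

(** Up to the factor 2, this is w' cosh (A F) - A exp (w) sinh (A F), that is
    the Wronskian of exp w and cosh (A F) as functions of F. *)
Let phi x := w1 x * (e x + e' x) - A * (expR (w x) * (e x - e' x)).

Let dphi (x : R) : `|x| < a ->
  is_derive x 1 phi ((w2 x - A ^+ 2 * expR (2 * w x)) * (e x + e' x)).
Proof.
move=> xa; have dexpw : is_derive x 1 (fun y => expR (w y)) (expR (w x) * w1 x).
  exact: is_derive_comp (dw xa).
apply: is_derive_eq.
  apply: is_derive_sub.
    apply: is_derive_mul; first exact: dw1.
    by apply: is_derive_add; [exact: de|exact: de'].
  apply: is_derive_mull; apply: (is_derive_mul dexpw).
  by apply: is_derive_sub; [exact: de|exact: de'].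
have -> : expR (2 * w x) = expR (w x) * expR (w x) by rewrite -expRD mulr_natl mulr2n.
by ring.
Qed.

Let norm_between x y z : `|x| < a -> `|y| < a -> x <= z <= y -> `|z| < a.
Proof. by rewrite !ltr_norml => /andP[? ?] /andP[? ?] /andP[? ?]; apply/andP; lra. Qed.

Let phi_le x y : `|x| < a -> `|y| < a -> x <= y -> phi x <= phi y.
Proof.
move=> xa ya xy; apply: (derive_ge0_le xy) => z /(norm_between xa ya) za.
  exact: dphi.
apply: mulr_ge0; last by rewrite addr_ge0 ?expR_ge0.
rewrite subr_ge0 -ler_pdivlMr ?expR_gt0// -expRN -mulNr; exact: w2_ge.
Qed.

Let phi0 : phi 0 = 0.
Proof. by rewrite /phi /e /e' w10 F0 !mulr0 subrr !mulr0 mul0r subrr. Qed.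

(** The logarithm of exp w / (2 cosh (A F)). *)
Let psi x := w x - ln (e x + e' x).

Let dpsi (x : R) : `|x| < a -> is_derive x 1 psi (phi x / (e x + e' x)).
Proof.
move=> xa; have s0 : 0 < e x + e' x by rewrite addr_gt0 ?expR_gt0.
apply: is_derive_eq.
  apply: is_derive_sub; first exact: dw.
  apply: is_derive_comp; first exact: is_derive1_ln.
  by apply: is_derive_add; [exact: de|exact: de'].
by rewrite /phi; field; exact: lt0r_neq0.
Qed.

(** The differential inequality makes the Wronskian phi nondecreasing, and phi
    vanishes at 0; so psi, whose derivative has the sign of phi, is minimal
    at 0. *)
Lemma cosh_le_expR x : `|x| < a -> expR (A * F x) + expR (- A * F x) <= 2 * expR (w x).
Proof.
move=> xa; have a0 : `|0 : R| < a by rewrite normr0 (le_lt_trans _ xa).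
suff : psi 0 <= psi x.
  rewrite /psi w00 /e /e' F0 !mulr0 expR0 sub0r => h.
  rewrite -ler_ln ?posrE ?addr_gt0 ?mulr_gt0 ?expR_gt0//.
  rewrite lnM ?posrE ?expR_gt0// expRK.
  by rewrite (_ : 2 = 1 + 1)//; lra.
have [x0|/ltW x0] := leP 0 x.
  apply: (derive_ge0_le x0) => z zx; have za := norm_between a0 xa zx.
    exact: dpsi.
  apply: divr_ge0; last by rewrite addr_ge0 ?expR_ge0.
  by case/andP: zx => z0 _; rewrite -[leLHS]phi0 phi_le.
rewrite -lerN2; apply: (derive_ge0_le (f := fun y => - psi y) x0) => z zx;
  have za := norm_between xa a0 zx.
  apply: (@is_derive_eq _ _ _ (- psi)); first by apply: is_deriveN; exact: dpsi.
  reflexivity.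
rewrite oppr_ge0 pmulr_lle0 ?invr_gt0 ?addr_gt0 ?expR_gt0//.
by case/andP: zx => _ z0; rewrite -[leRHS]phi0 phi_le.
Qed.

End cosh_comparison.

(** * Left inverses of expanding maps *)

Section clamped_inverse.
Variables (R : realType) (T : R -> R) (a : R).
Hypothesis a_gt0 : 0 < a.
Hypothesis T_expands : forall x y : R, `|x| < a -> `|y| < a -> x <= y ->
  y - x <= T y - T x.
Hypothesis T_continuous : forall x : R, `|x| < a -> {for x, continuous T}.

(** Adding - a to the set makes the function equal to - a to the left of the image
    of T; to the right of the image it is a. *)
Definition clamped_inverse (z : R) : R :=
  sup ([set - a] `|` [set x | `|x| < a /\ T x <= z]).

Let clamped_ub z : ubound ([set - a] `|` [set x | `|x| < a /\ T x <= z]) a.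
Proof.
move=> x [->|[+ _]]; first by rewrite (le_trans _ (ltW a_gt0))// oppr_le0 ltW.
by rewrite ltr_norml => /andP[_ /ltW].
Qed.

Let le_clamped z x : x <= - a \/ (`|x| < a /\ T x <= z) -> x <= clamped_inverse z.
Proof.
have hs : has_ubound ([set - a] `|` [set x | `|x| < a /\ T x <= z]) by exists a.
case=> [xa|Tx]; last by apply: ub_le_sup => //; right.
by apply: (le_trans xa); apply: ub_le_sup => //; left.
Qed.

Let clamped_le z y : - a <= y -> (forall x, `|x| < a -> T x <= z -> x <= y) ->
  clamped_inverse z <= y.
Proof.
move=> ay xy; apply: ge_sup; first by exists (- a); left.
by move=> x [->//|[xa Tx]]; exact: xy.
Qed.

(** A Galois connection: the preimage of ]x, y] by the clamped inverse is
    therefore ]T x, T y]. *)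
Lemma clamped_inverse_le y z : `|y| < a -> (clamped_inverse z <= y) = (z <= T y).
Proof.
move=> ya; have /andP[ay1 ay2] : - a < y < a by rewrite -ltr_norml.
apply/idP/idP => [|zTy]; last first.
  apply: clamped_le => [|x xa Txz]; first exact: ltW.
  rewrite leNgt; apply/negP => yx.
  by have := T_expands ya xa (ltW yx); lra.
apply: contraTT; rewrite -!ltNge => Tyz.
have : \forall x \near y, T x < z /\ `|x| < a.
  apply: filterI; first exact: (cvgr_lt (T y) (T_continuous ya) z Tyz).
  exact: (@cvgr_norm_lt R R^o R (nbhs y) _ id y cvg_id a ya).
move=> /nbhs_ballP[e /= e0 eT]; pose x := y + e / 2.
have yx : y < x by rewrite ltrDl divr_gt0.
have [|Tx xa] := eT x.
  by rewrite /ball/= opprD addNKr normrN gtr0_norm ?divr_gt0//; lra.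
apply: (lt_le_trans yx); apply: le_clamped; right; split => //; exact: ltW.
Qed.

(** If T x <= v then T (x - (v - u)) <= u because T expands; so lowering the
    level from v to u lowers the supremum by at most v - u. *)
Lemma clamped_inverse_lip u v :
  `|clamped_inverse u - clamped_inverse v| <= `|u - v|.
Proof.
wlog uv : u v / u <= v.
  by move=> H; case/orP: (le_total u v) => /H//; rewrite distrC [leRHS]distrC.
have le1 : clamped_inverse u <= clamped_inverse v.
  apply: clamped_le => [|x xa Tx]; apply: le_clamped; [by left|right; split=> //].
  exact: le_trans uv.
have le2 : clamped_inverse v <= clamped_inverse u + (v - u).
  apply: clamped_le => [|x xa Tx].
    have : - a <= clamped_inverse u by apply: le_clamped; left.
    lra.
  rewrite -lerBlDr; apply: le_clamped.
  have [|ax] := leP (x - (v - u)) (- a); [by left|right].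
  have xa' : `|x - (v - u)| < a.
    by move: xa; rewrite !ltr_norml => /andP[? ?]; apply/andP; split; lra.
  have xx : x - (v - u) <= x by lra.
  by split => //; have := T_expands xa' xa xx; lra.
by rewrite distrC [leRHS]distrC !ger0_norm ?subr_ge0//; lra.
Qed.

End clamped_inverse.

(** * Images of measures with a density *)

Section weighted_transfer.
Local Open Scope ereal_scope.
Context d (X Y : measurableType d) (R : realType).
Variable mu : {measure set X -> \bar R}.

Import HBNNSimple.

Lemma integral_simple_weighted (phi : X -> Y) (g : X -> R)
    (h : {nnsfun Y >-> R}) :
  measurable_fun setT phi -> measurable_fun setT g -> (forall x, (0 <= g x)%R) ->
  \int[mu]_x ((h (phi x))%:E * (g x)%:E) =
  \sum_(r \in range h) r%:E *
     \int[mu]_x ((\1_(h @^-1` [set r]) (phi x))%:E * (g x)%:E).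
Proof.
move=> mphi mg g0.
have mh r : measurable (h @^-1` [set r]) by exact: measurable_funPTI.
transitivity (\int[mu]_x \sum_(r \in range h)
    ((r * \1_(h @^-1` [set r]) (phi x))%:E * (g x)%:E)).
  apply: eq_integral => x _.
  rewrite -ge0_mule_fsuml => [|r]; last exact: nnfun_muleindic_ge0.
  by rewrite fsumEFin// -fimfunE.
have mi r : measurable_fun setT (fun x : X => \1_(h @^-1` [set r]) (phi x) : R).
  by apply: measurableT_comp mphi; exact: measurable_indic.
rewrite ge0_integral_fsum//; last 2 first.
- move=> r; apply: emeasurable_funM; apply/measurable_EFinP => //.
  exact: measurable_funM.
- by move=> r x _; rewrite mule_ge0 ?lee_fin// -lee_fin nnfun_muleindic_ge0.
apply: eq_fsbigr => r; rewrite inE => -[y _ <-].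
under eq_integral do rewrite EFinM -muleA.
rewrite ge0_integralZl//; first by apply: emeasurable_funM; apply/measurable_EFinP.
- by move=> x _; rewrite mule_ge0// lee_fin.
- by rewrite lee_fin.
Qed.

Lemma integral_weighted_lim (phi : X -> Y) (g : X -> R) (f : Y -> \bar R)
    (mf : measurable_fun setT f) :
  measurable_fun setT phi -> measurable_fun setT g -> (forall x, (0 <= g x)%R) ->
  (forall y, 0 <= f y) ->
  \int[mu]_x (f (phi x) * (g x)%:E) = limn (fun n =>
    \int[mu]_x ((nnsfun_approx measurableT mf n (phi x))%:E * (g x)%:E)).
Proof.
move=> mphi mg g0 f0; set h := nnsfun_approx _ _.
rewrite -monotone_convergence//.
- apply: eq_integral => x _; apply/esym/cvg_lim => //.
  by apply: cvgeZr => //; exact: cvg_nnsfun_approx.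
- move=> n; apply: emeasurable_funM; apply/measurable_EFinP => //.
  exact: measurableT_comp.
- by move=> n x _; rewrite mule_ge0 ?lee_fin.
- move=> x _ m n mn; rewrite lee_wpmul2r ?lee_fin//.
  exact/lefP/nd_nnsfun_approx.
Qed.

(** Equality of two image measures with densities, tested on sets, extends to
    nonnegative functions by monotone approximation with simple functions. *)
Lemma eq_integral_weighted (phi psi : X -> Y) (g h : X -> R) :
  measurable_fun setT phi -> measurable_fun setT psi ->
  measurable_fun setT g -> measurable_fun setT h ->
  (forall x, (0 <= g x)%R) -> (forall x, (0 <= h x)%R) ->
  (forall E, measurable E ->
    \int[mu]_x ((\1_E (phi x))%:E * (g x)%:E) =
    \int[mu]_x ((\1_E (psi x))%:E * (h x)%:E)) ->
  forall f : Y -> \bar R, measurable_fun setT f -> (forall y, 0 <= f y) ->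
    \int[mu]_x (f (phi x) * (g x)%:E) = \int[mu]_x (f (psi x) * (h x)%:E).
Proof.
move=> mphi mpsi mg mh g0 h0 gh f mf f0.
rewrite !(integral_weighted_lim mf)//; congr (limn _); apply/funext => n.
rewrite !integral_simple_weighted//; apply: eq_fsbigr => r _.
by congr (_ * _); apply: gh; exact: measurable_funPTI.
Qed.

End weighted_transfer.

Section image_density.
Variable R : realType.
Notation mu := (@lebesgue_measure R).
Implicit Types (k : R -> R) (S : R -> R) (E : set (measurableTypeR R)).

Definition image_density k S E : \bar R :=
  (\int[mu]_(z in S @^-1` E) (k z)%:E)%E.

Lemma image_densityE k S E :
  image_density k S E = (\int[mu]_z ((\1_E (S z))%:E * (k z)%:E))%E.
Proof.
rewrite /image_density integral_mkcond; apply: eq_integral => z _.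
rewrite patchE indicE (_ : (z \in S @^-1` E) = (S z \in E))//.
by case: (S z \in E); rewrite ?mul1e ?mul0e.
Qed.

Section image_density_measure.
Variables (k S : R -> R).
Hypotheses (mk : measurable_fun setT k) (k0 : forall z, 0 <= k z).
Hypothesis mS : measurable_fun setT S.

Let measurable_preimage E : measurable E -> measurable (S @^-1` E).
Proof. by move=> mE; rewrite -[X in measurable X]setTI; exact: mS. Qed.

Lemma image_density0 : image_density k S set0 = 0%E.
Proof. by rewrite /image_density preimage_set0 integral_set0. Qed.

Lemma image_density_ge0 E : (0 <= image_density k S E)%E.
Proof. by apply: integral_ge0 => z _; rewrite lee_fin. Qed.

Lemma image_density_sigma_additive : semi_sigma_additive (image_density k S).
Proof.
move=> F mF tF mUF; rewrite /image_density preimage_bigcup ge0_integral_bigcup.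
- apply: is_cvg_ereal_nneg_natsum_cond => n _ _.
  by apply: integral_ge0 => z _; rewrite lee_fin.
- by move=> i; exact: measurable_preimage.
- apply/measurable_EFinP; exact: measurable_funTS.
- by move=> z _; rewrite lee_fin.
- apply/trivIsetP => /= i j _ _ ij; rewrite -preimage_setI.
  by move/trivIsetP : tF => /(_ _ _ _ _ ij) ->//; rewrite preimage_set0.
Qed.

(** Stated as an existence so that later uses see an opaque measure. *)
Lemma image_density_measure :
  exists m : {measure set (measurableTypeR R) -> \bar R},
    forall E, m E = image_density k S E.
Proof.
pose m : {measure set (measurableTypeR R) -> \bar R} :=
  HB.pack (image_density k S) (isMeasure.Build _ _ _ (image_density k S)
  image_density0 image_density_ge0 image_density_sigma_additive).
by exists m.
Qed.

End image_density_measure.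

(** The two measures may be infinite, with all their mass escaping to the end
    points; they are compared on the intervals ]- b, b] with b < a, where
    they are finite and where uniqueness of measures applies, and then
    b tends to a. *)
Lemma eq_image_density (k l S : R -> R) (a : R) : 0 < a ->
  measurable_fun setT k -> (forall z, 0 <= k z) ->
  measurable_fun setT l -> (forall z, 0 <= l z) -> measurable_fun setT S ->
  (forall z, a <= `|S z| -> k z = 0) -> (forall z, a <= `|z| -> l z = 0) ->
  (forall x y, `|x| < a -> `|y| < a -> x < y ->
    image_density k S `]x, y]%classic = image_density l id `]x, y]%classic /\
    (image_density k S `]x, y]%classic < +oo)%E) ->
  forall E, measurable E -> image_density k S E = image_density l id E.
Proof.
move=> a0 mk k0 ml l0 mS ka la kl E mE.
have mid : measurable_fun setT (@id R) by exact: measurable_id.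
have [m1 m1E] := image_density_measure mk k0 mS.
have [m2 m2E] := image_density_measure ml l0 mid.
pose b (n : nat) := a - a / n.+1%:R.
have ba n : b n < a by rewrite ltrBlDr ltrDl divr_gt0.
pose I (n : nat) : set (measurableTypeR R) := `]- b n, b n]%classic.
have mI n : measurable (I n) by exact: measurable_itv.
have m12 n : m1 (E `&` I n) = m2 (E `&` I n).
  have klI x y : m1 (`]x, y]%classic `&` I n) = m2 (`]x, y]%classic `&` I n) /\
      (m1 (`]x, y]%classic `&` I n) < +oo)%E.
    have -> : `]x, y]%classic `&` I n =
        `]Num.max x (- b n), Num.min y (b n)]%classic.
      apply/seteqP; split => z; rewrite /I /= !in_itv/= gt_max le_min.
        by move=> [/andP[-> ->] /andP[-> ->]].
      by move=> /andP[/andP[-> ->] /andP[-> ->]].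
    set x' := Num.max _ _; set y' := Num.min _ _.
    have [xy'|yx'] := ltP x' y'; last first.
      by rewrite set_itv_ge ?bnd_simp -?leNgt// !measure0.
    have bx' : - b n <= x' by rewrite le_max lexx orbT.
    have yb' : y' <= b n by rewrite ge_min lexx orbT.
    have := ba n; rewrite m1E m2E => ban.
    by apply: kl => //; rewrite ltr_norml; apply/andP; split; lra.
  apply: (@measure_unique _ R (measurableTypeR R) (@ocitv R)
     (fun i => `](- (i%:R : R)), (i%:R : R)]%classic) _ _ _ _
     (mrestr m1 (mI n)) (mrestr m2 (mI n))) => //.
  - exact: ocitvI.
  - by move=> i; exact: is_ocitv.
  - apply/seteqP; split => // z _; exists (Num.truncn `|z|).+1 => //=.
    by rewrite in_itv/=; have := truncnS_gt `|z|;
      rewrite ltr_norml => /andP[-> /ltW ->].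
  - by move=> _ [[x y] _ <-]; exact: (klI x y).1.
  - by move=> i; exact: (klI _ _).2.
have IE : \bigcup_n (E `&` I n) = E `&` `]- a, a[%classic.
  apply/seteqP; split => z /=; rewrite in_itv/=.
    move=> [n _ [Ez]]; rewrite /I/= in_itv/= => /andP[? ?]; split => //.
    by have := ba n => ?; apply/andP; split; lra.
  rewrite -ltr_norml => -[Ez za]; have az : 0 < a - `|z| by lra.
  pose n := Num.truncn (a / (a - `|z|)); exists n => //; split => //.
  have zb : `|z| < b n.
    by rewrite /b ltrBrDl -ltrBrDr ltr_pdivrMr// mulrC -ltr_pdivrMr// truncnS_gt.
  by move: zb; rewrite ltr_norml /I/= in_itv/= => /andP[-> /ltW ->].
have ndEI : nondecreasing_seq (fun n => E `&` I n).
  move=> i j ij; apply/subsetPset => z [Ez Iz]; split => //.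
  move: Iz; rewrite /I/= !in_itv/=.
  have : b i <= b j.
    by rewrite lerD2l lerN2 ler_pM2l// lef_pV2 ?posrE// ler_nat.
  by move=> ? /andP[? ?]; apply/andP; split; lra.
have mEI n : measurable (E `&` I n) by exact: measurableI.
have lim (m : {measure set (measurableTypeR R) -> \bar R}) :
    m (E `&` I n) @[n --> \oo] --> m (E `&` `]- a, a[%classic).
  rewrite -IE; apply: nondecreasing_cvg_mu => //.
  by apply: bigcupT_measurable => n; exact: mEI.
have inside h (T : R -> R) : (forall z, a <= `|T z| -> h z = 0) ->
    image_density h T E = image_density h T (E `&` `]- a, a[%classic).
  move=> ha; rewrite !image_densityE; apply: eq_integral => z _.
  rewrite !indicE in_setI; have [/ha ->|Tza] := leP a `|T z|; first by rewrite !mule0.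
  by rewrite [X in _ && X]mem_set ?andbT//= in_itv/= -ltr_norml.
have inside1 : m1 E = m1 (E `&` `]- a, a[%classic).
  by rewrite !m1E inside.
have inside2 : m2 E = m2 (E `&` `]- a, a[%classic).
  by rewrite !m2E inside.
rewrite -m1E -m2E inside1 inside2.
apply: (cvg_unique _ (lim m1)) => //.
have -> : (fun n => m1 (E `&` I n)) = (fun n => m2 (E `&` I n)) by apply/funext.
exact: lim.
Qed.

End image_density.

(** * Transport of the secant measure on the line *)

Section transport_data.
Variable R : realType.

Definition secant (A x : R) : R :=
  if `|x| < pi / (2 * A) then (cos (A * x))^-1 else 0.

(** The density of mu_A restricted to the points that S sends into ]-a, a[. *)
Definition secant_pre (A a : R) (S : R -> R) (x : R) : R :=
  if `|S x| < a then secant A x else 0.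

(** The density of exp W dx restricted to ]-a, a[, hence real-valued. *)
Definition exp_inside (W : R -> \bar R) (a x : R) : R :=
  if `|x| < a then expR (fine (W x)) else 0.

(** What the product argument needs from each coordinate.  The points +-a are
    left out, since W may be finite or infinite there. *)
Record secant_transport (A : R) (W : R -> \bar R) (a : R) (S : R -> R) : Prop :=
  SecantTransport {
    transport_lip : forall u v, `|S u - S v| <= `|u - v| ;
    transport_infinite : forall x, a < `|x| -> W x = +oo%E ;
    transport_finite : forall x, `|x| < a -> W x \is a fin_num ;
    transport_integral : forall f : R -> \bar R,
      measurable_fun setT f -> (forall x, (0 <= f x)%E) ->
      (\int[@lebesgue_measure R]_x (f (S x) * (secant_pre A a S x)%:E) =
       \int[@lebesgue_measure R]_x (f x * (exp_inside W a x)%:E))%E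
  }.

Lemma secant_ge0 (A x : R) : 0 < A -> 0 <= secant A x.
Proof.
move=> A0; rewrite /secant; case: ifPn => // xc.
by rewrite invr_ge0 ltW// cos_scaled_gt0.
Qed.

Lemma secant_pre_ge0 (A a : R) S x : 0 < A -> 0 <= secant_pre A a S x.
Proof. by move=> A0; rewrite /secant_pre; case: ifP => // _; exact: secant_ge0. Qed.

Lemma exp_inside_ge0 W (a x : R) : 0 <= exp_inside W a x.
Proof. by rewrite /exp_inside; case: ifP => // _; exact: expR_ge0. Qed.

Lemma measurable_secant (A : R) : 0 < A -> measurable_fun setT (secant A).
Proof.
move=> A0; set c := pi / (2 * A).
rewrite (_ : secant A = (fun x => (cos (A * x))^-1) \_ `]- c, c[); last first.
  apply/funext => x; rewrite /secant patchE.
  by congr (if _ then _ else _); rewrite ltr_norml mem_setE in_itv.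
suff : measurable_fun `]- c, c[%classic (fun x : R => (cos (A * x))^-1).
  by move/(measurable_restrictT _ (measurable_itv _)).
apply: open_continuous_measurable_fun; first exact: interval_open.
by move=> x; rewrite inE/= in_itv/= -ltr_norml; exact: continuous_secant_inv.
Qed.

Lemma lip_measurable (S : R -> R) :
  (forall u v, `|S u - S v| <= `|u - v|) -> measurable_fun setT S.
Proof.
move=> lipS; apply: continuous_measurable_fun => x.
apply/cvgrPdist_lt => e e0; near=> y.
rewrite (le_lt_trans (lipS _ _))//; near: y.
Unshelve. all: by end_near. Qed.

Lemma measurable_norm_lt (a : R) (S : R -> R) : measurable_fun setT S ->
  measurable_fun setT (fun x => `|S x| < a).
Proof.
move=> mS; apply: measurable_fun_ltr; last exact: measurable_cst.
by apply: measurableT_comp mS; exact: normr_measurable.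
Qed.

Lemma measurable_secant_pre (A a : R) S : 0 < A -> measurable_fun setT S ->
  measurable_fun setT (secant_pre A a S).
Proof.
move=> A0 mS; apply: measurable_fun_ifT; first exact: measurable_norm_lt.
- exact: measurable_secant.
- exact: measurable_cst.
Qed.

(** The sublevel sets are intervals. *)
Lemma quasiconvex_measurable (f : R -> \bar R) :
  (forall x y z, x <= z <= y -> (f z <= f x \/ f z <= f y)%E) ->
  measurable_fun setT f.
Proof.
move=> qf; apply: (measurability _ (ErealGenOInfty.measurableE R)).
move=> _ [_ [r ->] <-]; rewrite setTI.
rewrite (_ : _ @^-1` _ = ~` [set x | (f x <= r%:E)%E]).
  apply: measurableC; apply: (@is_interval_measurable R) => x y /= fx fy z xzy.
  by have [fz|fz] := qf _ _ _ xzy; exact: le_trans fz _.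
apply/seteqP; split => x /=; rewrite in_itv/= andbT; first by rewrite ltNge => /negP.
by move=> /negP; rewrite -ltNge.
Qed.

Lemma econvex_quasiconvex (W : R -> \bar R) : econvex W ->
  (forall x, 0 <= W x)%E ->
  forall x y z, x <= z <= y -> (W z <= W x \/ W z <= W y)%E.
Proof.
move=> cW W0 x y z /andP[xz zy].
have [xy|/negP] := boolP (x < y); last first.
  move=> /negP; rewrite -leNgt => yx; left.
  by rewrite (_ : z = x)//; apply/eqP; rewrite eq_le xz (le_trans zy).
pose t := (y - z) / (y - x).
have t01 : 0 <= t <= 1.
  by rewrite /t divr_ge0 ?subr_ge0 ?(ltW xy)//= ler_pdivrMr ?subr_gt0// mul1r lerD2l lerN2.
have -> : z = t * x + (1 - t) * y.
  by rewrite /t; field; rewrite subr_eq0 gt_eqF.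
move: (cW x y t t01) (W0 x) (W0 y).
case: (W x) => [u||]; [|by left; rewrite leey|by []].
case: (W y) => [v||]; [|by right; rewrite leey|by []].
move=> + _ _; rewrite -!EFinM -EFinD => Wz; case/andP: t01 => t0 t1.
have [uv|vu] := leP u v; [right|left]; rewrite (le_trans Wz)// lee_fin.
  rewrite (@le_trans _ _ (t * v + (1 - t) * v))// ?lerD2r ?ler_wpM2l//.
  by rewrite -mulrDl subrKC mul1r.
rewrite (@le_trans _ _ (t * u + (1 - t) * u))// ?lerD2l ?ler_wpM2l ?subr_ge0 ?(ltW vu)//.
by rewrite -mulrDl subrKC mul1r.
Qed.

Lemma measurable_expeR_convex (W : R -> \bar R) : econvex W ->
  (forall x, 0 <= W x)%E -> measurable_fun setT (fun x => expeR (W x)).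
Proof.
move=> cW W0; apply: quasiconvex_measurable => x y z xzy; rewrite !lee_expeR.
exact: econvex_quasiconvex.
Qed.

Lemma measurable_exp_inside (W : R -> \bar R) a : econvex W ->
  (forall x, 0 <= W x)%E -> measurable_fun setT (exp_inside W a).
Proof.
move=> cW W0; apply: measurable_fun_ifT; last exact: measurable_cst.
  exact: (@measurable_norm_lt a id).
apply: measurableT_comp; first exact: measurable_expR.
apply: measurableT_comp; first exact: fine_measurable.
apply: (@quasiconvex_measurable W); exact: econvex_quasiconvex.
Qed.

End transport_data.

Section one_dimensional_transport.
Variables (R : realType) (A : R) (W : R -> \bar R).
Notation mu := (@lebesgue_measure R).
Hypothesis A_gt0 : 0 < A.
Hypothesis W_neqNy : forall x, W x != -oo%E.
Hypothesis W_convex : econvex W.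
Hypothesis W_even : forall x, W (- x) = W x.
Hypothesis W0 : W 0 = 0%E.
Hypothesis W_ineq : forall x : R, (interior [set y : R | W y \is a fin_num]) x ->
    [/\ derivable (fine \o W) x 1,
        derivable (derive1 (fine \o W)) x 1 &
        A ^+ 2 <= derive1n 2 (fine \o W) x * expR (- 2 * fine (W x))].

Let w : R -> R := fine \o W.

Lemma even_econvex_ge0 x : (0 <= W x)%E.
Proof.
have h01 : 0 <= (2^-1 : R) <= 1 by apply/andP; split; lra.
have := W_convex x (- x) h01; rewrite mulrN (_ : 1 - 2^-1 = 2^-1); last by lra.
rewrite subrr W0 W_even; move: (W_neqNy x).
case: (W x) => [r _||//]; last by rewrite leey.
by rewrite -!EFinM -EFinD !lee_fin; lra.
Qed.

Let finite_between x y : `|x| <= `|y| -> W y \is a fin_num -> W x \is a fin_num.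
Proof.
move=> xy Wy; rewrite ge0_fin_numE ?even_econvex_ge0//.
have Wny : W `|y| = W y by case: (ger0P y) => // _; rewrite W_even.
have : - `|y| <= x <= `|y| by rewrite -ler_norml.
move=> /(econvex_quasiconvex W_convex even_econvex_ge0).
rewrite W_even Wny => Wx; apply: (@le_lt_trans _ _ (W y)); first by case: Wx.
by rewrite -ge0_fin_numE ?even_econvex_ge0.
Qed.

(** The map is gud A composed with the primitive F of exp w vanishing at 0. *)
Let expanding_map (a : R) : (forall x, `|x| < a -> W x \is a fin_num) ->
  exists T : R -> R,
    [/\ forall x, `|T x| < pi / (2 * A),
        forall x y : R, `|x| < a -> `|y| < a -> x <= y -> y - x <= T y - T x,
        forall x : R, `|x| < a -> {for x, continuous T} &
        forall x y : R, `|x| < a -> `|y| < a -> x < y ->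
          (\int[mu]_(z in `]T x, T y]) ((cos (A * z))^-1)%:E =
           \int[mu]_(z in `]x, y]) (expR (w z))%:E)%E /\
          (\int[mu]_(z in `]x, y]) (expR (w z))%:E < +oo)%E].
Proof.
move=> Wfin; have [a0|a0] := leP a 0.
  exists (cst 0); split=> //.
  - by move=> x; rewrite normr0 divr_gt0 ?pi_gt0// mulr_gt0.
  - by move=> x y xa; exfalso; have := normr_ge0 x; lra.
  - by move=> x xa; exact: cst_continuous.
  - by move=> x y xa; exfalso; have := normr_ge0 x; lra.
have inside (x : R) : `|x| < a -> (interior [set y : R | W y \is a fin_num]) x.
  move=> xa; apply: (@filterS _ _ _ [set y : R | `|y| < a]).
    by move=> y /= ya; exact: Wfin.
  exact: (@cvgr_norm_lt R R^o R (nbhs x) _ id x cvg_id a xa).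
have dw (x : R) : `|x| < a -> is_derive x 1 w (derive1 w x).
  move=> /inside/W_ineq[dwx _ _].
  by apply: DeriveDef; [exact: dwx|rewrite derive1E].
have dw1 (x : R) : `|x| < a -> is_derive x 1 (derive1 w) (derive1n 2 w x).
  move=> /inside/W_ineq[_ dwx _].
  by apply: DeriveDef; [exact: dwx|rewrite derive1nS derive1n1 derive1E].
have w2 (x : R) : `|x| < a -> A ^+ 2 <= derive1n 2 w x * expR (- 2 * w x).
  by move=> /inside/W_ineq[].
have z0 : `|0 : R| < a by rewrite normr0.
have w00 : w 0 = 0 by rewrite /w/= W0.
(* the derivative of an even function is odd *)
have w10 : derive1 w 0 = 0.
  have dwN : is_derive (0 : R) 1 (fun y : R => w (- y)) (derive1 w 0 * -1).
    apply: (is_derive_comp (f := w) (g := -%R)).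
    by rewrite oppr0; exact: dw.
  have wN : (fun y : R => w (- y)) = w.
    by apply/funext => y; rewrite /w/= W_even.
  rewrite wN in dwN; have := dw 0 z0 => -[_ e1]; case: dwN => _.
  by rewrite e1; lra.
have cw (x : R) : `|x| < a -> {for x, continuous (fun y => expR (w y))}.
  move=> xa; apply: (is_derive_continuous (df := expR (w x) * derive1 w x)).
  by apply: (is_derive_comp (f := expR) (g := w)); exact: dw.
have [F [F0 dF]] := exists_antiderivative cw.
have Fe := cosh_le_expR dw dw1 dF w2 w00 w10 F0.
pose T x := gud A (F x).
have dT (x : R) : `|x| < a ->
    is_derive x 1 T (2 / (expR (A * F x) + expR (- A * F x)) * expR (w x)).
  move=> xa; apply: (is_derive_comp (f := gud A) (g := F)); last exact: dF.
  exact: is_derive_gud.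
have between (x y z : R) : `|x| < a -> `|y| < a -> x <= z <= y -> `|z| < a.
  by rewrite !ltr_norml => /andP[? ?] /andP[? ?] /andP[? ?]; apply/andP; split; lra.
have T_expands (x y : R) : `|x| < a -> `|y| < a -> x <= y -> y - x <= T y - T x.
  move=> xa ya xy; have [z zxy Txy] := mean_value xy (fun z h => dT z (between _ _ _ xa ya h)).
  have za := between _ _ _ xa ya zxy.
  rewrite Txy ler_peMl ?subr_ge0// mulrAC ler_pdivlMr ?addr_gt0 ?expR_gt0//.
  by rewrite mul1r; exact: Fe.
have cT (x : R) : `|x| < a -> {for x, continuous T}.
  by move=> xa; exact: is_derive_continuous (dT _ xa).
have Tc x : `|T x| < pi / (2 * A) by exact: gud_bound.
exists T; split => // x y xa ya xy.
have Txy : T x < T y by have := T_expands _ _ xa ya (ltW xy); lra.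
have Tbetween z : T x <= z <= T y -> `|z| < pi / (2 * A).
  have := Tc x; have := Tc y; rewrite !ltr_norml.
  by move=> /andP[? ?] /andP[? ?] /andP[? ?]; apply/andP; split; lra.
have -> := integral_derive Txy
  (fun z h => is_derive_secant_primitive A_gt0 (Tbetween z h))
  (fun z h => continuous_secant_inv A_gt0 (Tbetween z h)).
have -> := integral_derive xy (fun z h => dF z (between _ _ _ xa ya h))
  (fun z h => cw z (between _ _ _ xa ya h)).
by rewrite !gudK// ltry.
Qed.

Let outside_infinite (a : R) : (forall y, W y \is a fin_num -> `|y| <= a) ->
  forall x, a < `|x| -> W x = +oo%E.
Proof.
move=> fin_le x ax; have : ~ (W x \is a fin_num) by move=> /fin_le; lra.
by move: (W_neqNy x); case: (W x).
Qed.

(** The expanding map sends ]-a, a[ into ]-pi / (2 A), pi / (2 A)[, which bounds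
    the domain of W; its half-length a is thus a real number.  When W is finite
    at 0 only, a = 0 and both densities vanish identically. *)
Lemma exists_secant_transport : exists a S, secant_transport A W a S.
Proof.
have Wge0 := even_econvex_ge0.
have [[b0 b0_gt0 Wb0]|no_pos] :=
    pselect (exists2 b, 0 < b & W b \is a fin_num); last first.
  have fin0 y : W y \is a fin_num -> `|y| <= 0.
    move=> Wy; rewrite leNgt; apply/negP => y0; apply: no_pos; exists `|y| => //.
    by apply: finite_between Wy; rewrite normr_id.
  exists 0, (cst 0); split.
  - by move=> u v; rewrite subrr normr0.
  - exact: outside_infinite.
  - by move=> x; rewrite ltNge normr_ge0.
  - move=> f mf f0; apply: eq_integral => x _.
    rewrite /secant_pre /exp_inside normr0 ltxx.
    by rewrite ltNge normr_ge0/= !mule0.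
pose fins : set R := [set b | W b \is a fin_num].
have finle b : W b \is a fin_num -> `|b| <= pi / (2 * A).
  move=> Wb; have [|T [Tc Te _ _]] := @expanding_map `|b|.
    by move=> x xb; apply: finite_between Wb; exact: ltW.
  rewrite leNgt; apply/negP => cb.
  (* the segment [- x, x] is too long to be expanded into an interval of length
     pi / A *)
  pose x := (pi / (2 * A) + `|b|) / 2.
  have c0 : 0 < pi / (2 * A) by rewrite divr_gt0 ?pi_gt0// mulr_gt0.
  have x0 : 0 <= x by rewrite /x; lra.
  have xb : `|x| < `|b| by rewrite ger0_norm// /x; lra.
  have nx : `|- x| < `|b| by rewrite normrN.
  have nxx : - x <= x by lra.
  have := Te _ _ nx xb nxx; have := Tc x; have := Tc (- x).
  have xE : x = (pi / (2 * A) + `|b|) / 2 by [].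
  by rewrite !ltr_norml => /andP[? ?] /andP[? ?]; lra.
have ubfins : has_ubound fins.
  by exists (pi / (2 * A)) => b /finle; exact/le_trans/ler_norm.
pose a := sup fins.
have a0 : 0 < a by apply: (lt_le_trans b0_gt0); exact: ub_le_sup.
have fin_in x : `|x| < a -> W x \is a fin_num.
  move=> xa; have [|y Wy xy] := sup_gt _ xa; first by exists b0.
  by apply: finite_between Wy; rewrite (le_trans (ltW xy))// ler_norm.
have fin_out y : W y \is a fin_num -> `|y| <= a.
  move=> Wy; apply: ub_le_sup => //; apply: finite_between Wy.
  by rewrite normr_id.
have [T [Tc Te cT Tint]] := expanding_map fin_in.
pose S := clamped_inverse T a.
have Slip u v : `|S u - S v| <= `|u - v| by exact: clamped_inverse_lip.
have mS : measurable_fun setT S by exact: lip_measurable.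
exists a, S; split => //; first exact: outside_infinite.
move=> f mf f0.
apply: (@eq_integral_weighted _ (measurableTypeR R) (measurableTypeR R) R mu S id) => //.
- exact: measurable_secant_pre.
- exact: measurable_exp_inside.
- by move=> x; exact: secant_pre_ge0.
- by move=> x; exact: exp_inside_ge0.
move=> E mE; rewrite -!image_densityE.
apply: (@eq_image_density R _ _ S a) => //.
- exact: measurable_secant_pre.
- by move=> x; exact: secant_pre_ge0.
- exact: measurable_exp_inside.
- by move=> x; exact: exp_inside_ge0.
- by move=> z; rewrite /secant_pre leNgt => /negbTE ->.
- by move=> z; rewrite /exp_inside leNgt => /negbTE ->.
move=> x y xa ya xy; have [Txy Tfin] := Tint x y xa ya xy.
have between z : x < z <= y -> `|z| < a.
  by move: xa ya; rewrite !ltr_norml => /andP[? ?] /andP[? ?] /andP[? ?];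
    apply/andP; split; lra.
have -> : image_density (exp_inside W a) id `]x, y]%classic =
    (\int[mu]_(z in `]x, y]) (expR (w z))%:E)%E.
  apply: eq_integral => z; rewrite inE/= in_itv/= => /between za.
  by rewrite /exp_inside za.
have -> : image_density (secant_pre A a S) S `]x, y]%classic =
    (\int[mu]_(z in `]T x, T y]) ((cos (A * z))^-1)%:E)%E.
  have Sle z : (S z <= y) = (z <= T y) by exact: clamped_inverse_le.
  have Slt z : (x < S z) = (T x < z) by rewrite !ltNge; congr (~~ _); exact: clamped_inverse_le.
  rewrite /image_density; have -> : S @^-1` `]x, y]%classic = `]T x, T y]%classic.
    by apply/seteqP; split => z; rewrite /= !in_itv/= Sle Slt.
  apply: eq_integral => z; rewrite inE/= in_itv/= => /andP[Txz zTy].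
  have -> : secant_pre A a S z = secant A z.
    by rewrite /secant_pre between// Sle Slt Txz.
  rewrite /secant ifT//; have := Tc x; have := Tc y; rewrite !ltr_norml.
  by move=> /andP[? ?] /andP[? ?]; apply/andP; split; lra.
by rewrite Txy.
Qed.

End one_dimensional_transport.

(** * Product maps on the space of tuples *)

Section product_transfer.
Local Open Scope ereal_scope.
Variable R : realType.

Definition coordinatewise n (S : 'I_n -> R -> R) (x : Rspace R n) : Rspace R n :=
  [tuple S i (tnth x i) | i < n].

Lemma measurable_coordinatewise n (S : 'I_n -> R -> R) :
  (forall i, measurable_fun setT (S i)) -> measurable_fun setT (coordinatewise S).
Proof.
move=> mS; apply/measurable_fun_tnthP => i.
rewrite (_ : _ \o _ = S i \o (@tnth n (measurableTypeR R))^~ i); last first.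
  by apply/funext => x; rewrite /= tnth_mktuple.
by apply: measurableT_comp (measurable_tnth i); exact: mS.
Qed.

Lemma measurable_prod_tnth n (g : 'I_n -> R -> R) :
  (forall i, measurable_fun setT (g i)) ->
  measurable_fun [set: Rspace R n] (fun x => \prod_(i < n) g i (tnth x i))%R.
Proof.
move=> mg; apply: measurable_prod => i _.
by apply: measurableT_comp (measurable_tnth i); exact: mg.
Qed.

Lemma coordinatewise_Rcons n (S : 'I_n.+1 -> R -> R) x (y : Rspace R n) :
  coordinatewise S (Rcons (x, y)) =
  Rcons (S ord0 x, coordinatewise (fun i => S (lift ord0 i)) y).
Proof.
apply: eq_from_tnth => i; rewrite tnth_mktuple.
by have [j ->|->] := unliftP ord0 i; rewrite ?tnth0 ?tnthS ?tnth_mktuple.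
Qed.

Lemma integral_lebesgue_Rspace_cons n (f : Rspace R n.+1 -> \bar R) :
  measurable_fun setT f -> (forall x, 0 <= f x) ->
  \int[lebesgue_Rspace R n.+1]_x f x =
  \int[@lebesgue_measure R]_x \int[lebesgue_Rspace R n]_y f (Rcons (x, y)).
Proof.
move=> mf f0; rewrite /= /lebesgue_cons.
rewrite (ge0_integral_pushforward (@measurable_Rcons R n))//.
rewrite preimage_setT fubini_tonelli1//.
- by apply: measurableT_comp mf (@measurable_Rcons R n).
- by move=> p; exact: f0.
Qed.

(** By induction on the dimension: Tonelli separates the first coordinate, the
    induction hypothesis replaces the others, and the one-dimensional change
    of variables applies to the function of the first coordinate obtained by
    integrating out the others. *)
Lemma integral_coordinatewise n (S : 'I_n -> R -> R) (g h : 'I_n -> R -> R) :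
  (forall i, measurable_fun setT (S i)) ->
  (forall i, measurable_fun setT (g i)) -> (forall i, measurable_fun setT (h i)) ->
  (forall i x, (0 <= g i x)%R) -> (forall i x, (0 <= h i x)%R) ->
  (forall i (f : R -> \bar R), measurable_fun setT f -> (forall x, 0 <= f x) ->
    \int[@lebesgue_measure R]_x (f (S i x) * (g i x)%:E) =
    \int[@lebesgue_measure R]_x (f x * (h i x)%:E)) ->
  forall f : Rspace R n -> \bar R, measurable_fun setT f -> (forall x, 0 <= f x) ->
  \int[lebesgue_Rspace R n]_x
    (f (coordinatewise S x) * (\prod_(i < n) g i (tnth x i))%:E) =
  \int[lebesgue_Rspace R n]_x (f x * (\prod_(i < n) h i (tnth x i))%:E).
Proof.
elim: n S g h => [|n IH] S g h mS mg mh g0 h0 Sgh f mf f0.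
  by apply: eq_integral => x _; rewrite !big_ord0 (tuple0 x) (tuple0 (coordinatewise _ _)).
have mfR : measurable_fun setT (f \o @Rcons R n).
  by apply: measurableT_comp mf (@measurable_Rcons R n).
have mk (k : 'I_n.+1 -> R -> R) : (forall i, measurable_fun setT (k i)) ->
    measurable_fun [set: Rspace R n]
      (fun y => \prod_(i < n) k (lift ord0 i) (tnth y i))%R.
  move=> mk; exact: (@measurable_prod_tnth n (fun i => k (lift ord0 i))).
rewrite !integral_lebesgue_Rspace_cons; last 4 first.
- apply: emeasurable_funM; first exact: mf.
  by apply/measurable_EFinP; exact: measurable_prod_tnth.
- by move=> x; rewrite mule_ge0 ?lee_fin ?prodr_ge0.
- apply: emeasurable_funM.
    by apply: (measurableT_comp mf); exact: measurable_coordinatewise.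
  by apply/measurable_EFinP; exact: measurable_prod_tnth.
- by move=> x; rewrite mule_ge0 ?lee_fin ?prodr_ge0.
pose G z := \int[lebesgue_Rspace R n]_y
  (f (Rcons (z, y)) * (\prod_(i < n) h (lift ord0 i) (tnth y i))%:E).
have mG : measurable_fun setT G.
  apply: (@measurable_fun_fubini_tonelli_F _ _ _ _ _ (lebesgue_Rspace R n)
    (fun p => f (Rcons p) * (\prod_(i < n) h (lift ord0 i) (tnth p.2 i))%:E)).
    apply: emeasurable_funM => //; apply/measurable_EFinP.
    by apply: (measurableT_comp (mk h mh)).
  by move=> p; rewrite mule_ge0// lee_fin prodr_ge0.
have G0 z : 0 <= G z.
  by apply: integral_ge0 => y _; rewrite mule_ge0// lee_fin prodr_ge0.
have mfx x : measurable_fun [set: Rspace R n] (fun y => f (Rcons (x, y))).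
  by apply: (measurableT_comp mfR).
transitivity (\int[@lebesgue_measure R]_x (G (S ord0 x) * (g ord0 x)%:E)).
  apply: eq_integral => x _; rewrite /G.
  rewrite -(IH (fun i => S (lift ord0 i)) (fun i => g (lift ord0 i))
    (fun i => h (lift ord0 i)) _ _ _ _ _ _ (fun y => f (Rcons (S ord0 x, y))))//; last first.
    by move=> i; exact: Sgh.
  rewrite -ge0_integralZr//; last 3 first.
  - apply: emeasurable_funM; last by apply/measurable_EFinP; exact: (mk g mg).
    apply: (measurableT_comp (mfx _)).
    by apply: measurable_coordinatewise.
  - by move=> y _; rewrite mule_ge0// lee_fin prodr_ge0.
  - by rewrite lee_fin.
  apply: eq_integral => y _; rewrite coordinatewise_Rcons -muleA -EFinM.
  congr (_ * _%:E); rewrite big_ord_recl mulrC tnth0; congr (_ * _)%R.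
  by apply: eq_bigr => i _; rewrite tnthS.
rewrite (Sgh ord0 G mG G0); apply: eq_integral => x _; rewrite /G.
rewrite -ge0_integralZr//; last 3 first.
- by apply: emeasurable_funM; [exact: mfx|apply/measurable_EFinP; exact: (mk h mh)].
- by move=> y _; rewrite mule_ge0// lee_fin prodr_ge0.
- by rewrite lee_fin.
apply: eq_integral => y _; rewrite -muleA -EFinM.
congr (_ * _%:E); rewrite big_ord_recl mulrC tnth0; congr (_ * _)%R.
by apply: eq_bigr => i _; rewrite tnthS.
Qed.

End product_transfer.

(** * Open sets and boxes *)

Section box_topology.
Variable R : realType.

(** Openness for the sup norm, which is the same topology as the Euclidean one. *)
Definition box_open n (P : set (Rspace R n)) : Prop :=
  forall x, P x -> exists2 e : R, 0 < e &
    forall y, (forall i, `|(tnth y i : R) - tnth x i| < e) -> P y.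

Lemma measurable_box n (A : 'I_n -> set R) :
  (forall i, measurable (A i)) ->
  measurable [set x : Rspace R n | forall i, A i (tnth x i)].
Proof.
move=> mA; rewrite [X in measurable X](_ : _ =
  \bigcap_(i in [set: 'I_n]) ((@tnth n (measurableTypeR R))^~ i @^-1` A i)).
  apply: fin_bigcap_measurable => [|i _]; first exact: finite_finset.
  by have := @measurable_tnth _ (measurableTypeR R) n i measurableT _ (mA i);
    rewrite setTI.
by apply/seteqP; split=> [x xA i _|x xA i]; exact: xA.
Qed.

(** An open set is the union of the countably many rational boxes that it
    contains. *)
Lemma box_open_measurable n (P : set (Rspace R n)) : box_open P -> measurable P.
Proof.
move=> oP.
pose box (p : n.-tuple rat * rat) : set (Rspace R n) :=
  [set x | forall i, ball (ratr (tnth p.1 i) : R) (ratr p.2) (tnth x i)].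
have -> : P = \bigcup_p (if pselect (box p `<=` P) then box p else set0).
  apply/seteqP; split => [x Px|x [p _]]; last first.
    by case: (pselect (box p `<=` P)) => //= + ?; apply.
  have [e e0 eP] := oP _ Px.
  have [r] : exists r : rat, ratr r \in `]e / 4, e / 2[ by apply: rat_in_itvoo; lra.
  rewrite in_itv/= => /andP[er re].
  have near_rat i : exists q : rat, `|ratr q - (tnth x i : R)| < e / 4.
    have [|q] := @rat_in_itvoo R (tnth x i : R) ((tnth x i : R) + e / 4); first by lra.
    rewrite in_itv/= => /andP[? ?]; exists q.
    by rewrite ltr_norml; apply/andP; split; lra.
  have [q qx] := choice near_rat.
  exists ([tuple q i | i < n], r) => //.
  case: pselect => [_ i|]; rewrite /box /=.
    by rewrite tnth_mktuple /ball/= (lt_trans (qx i)).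
  apply: contra_notP => _ y /= yq; apply: eP => i.
  have := yq i; rewrite tnth_mktuple /ball/= => yqi.
  rewrite (_ : _ - _ = (ratr (q i) - (tnth x i : R)) -
    (ratr (q i) - (tnth y i : R))); last by ring.
  rewrite (le_lt_trans (ler_normB _ _))//.
  by have := qx i; lra.
apply: countable_bigcupT_measurable => // p.
rewrite (fun_if measurable); case: ifP => // _.
apply: (@measurable_box n (fun i => ball (ratr (tnth p.1 i) : R) (ratr p.2))).
by move=> i; exact: measurable_ball.
Qed.

(** Moving each coordinate by less than r <= 1 changes the sum s of the squares
    by at most r K, so r < (e ^ 2 - s) / K suffices; this replaces the
    triangle inequality. *)
Lemma eneigh_box_open n (e : R) (B : set (Rspace R n)) : box_open (eneigh e B).
Proof.
move=> x [y By xy]; pose u i := (tnth x i : R) - (tnth y i : R).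
set s := \sum_(i < n) u i ^+ 2; have s0 : 0 <= s by apply: sumr_ge0 => i _; exact: sqr_ge0.
pose K := \sum_(i < n) (2 * `|u i| + 1).
have K0 : 0 <= K by apply: sumr_ge0 => i _; rewrite addr_ge0// mulr_ge0.
have e0 : 0 < e by rewrite (le_lt_trans _ xy)// sqrtr_ge0.
have se : s < e ^+ 2.
  by rewrite -ltr_sqrt ?exprn_gt0// sqrtr_sqr gtr0_norm.
pose r := Num.min 1 ((e ^+ 2 - s) / (K + 1)).
have r0 : 0 < r by rewrite lt_min ltr01 divr_gt0 ?subr_gt0//; lra.
exists r => // z zx; exists y => //.
rewrite /Defs.edist -[ltRHS]gtr0_norm// -sqrtr_sqr ltr_sqrt ?exprn_gt0//.
have r1 : r <= 1 by rewrite ge_min lexx.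
have rK : r * K < e ^+ 2 - s.
  rewrite (@le_lt_trans _ _ ((e ^+ 2 - s) / (K + 1) * K))//.
    by rewrite ler_wpM2r// ge_min lexx orbT.
  by rewrite mulrAC ltr_pdivrMr ?ltr_pM2l ?subr_gt0//; lra.
suff : \sum_(i < n) ((tnth z i : R) - tnth y i) ^+ 2 <= s + r * K by lra.
rewrite /s /K mulr_sumr -big_split/=; apply: ler_sum => i _.
set v := (tnth z i : R) - tnth x i.
have -> : (tnth z i : R) - tnth y i = u i + v by rewrite /u /v; ring.
have vr : `|v| < r := zx i.
have uv : u i * v <= `|u i| * r.
  by rewrite (le_trans (ler_norm _))// normrM ler_wpM2l// ltW.
have v2 : v ^+ 2 <= r.
  rewrite -real_normK ?num_real// expr2 (@le_trans _ _ (1 * `|v|))//; last by lra.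
  by rewrite ler_wpM2r//; lra.
rewrite sqrrD -mulr_natl; lra.
Qed.

Lemma measurable_eneigh n (e : R) (B : set (Rspace R n)) :
  measurable (eneigh e B).
Proof. by apply: box_open_measurable; exact: eneigh_box_open. Qed.

Lemma edist_coordinatewise n (S : 'I_n -> R -> R) (x y : Rspace R n) :
  (forall i u v, `|S i u - S i v| <= `|u - v|) ->
  Defs.edist (coordinatewise S x) (coordinatewise S y) <= Defs.edist x y.
Proof.
move=> lipS; rewrite ler_wsqrtr//; apply: ler_sum => i _; rewrite !tnth_mktuple.
by rewrite -[leLHS]real_normK ?num_real// -[leRHS]real_normK ?num_real// ler_sqr.
Qed.

Lemma lebesgue_Rspace_coord_null n (i : 'I_n) (A : set R) : measurable A ->
  lebesgue_measure A = 0%E ->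
  lebesgue_Rspace R n [set x | A (tnth x i)] = 0%E.
Proof.
move=> mA A0; pose F j : set (measurableTypeR R) := if j == i then A else setT.
rewrite (_ : [set x | _] = [set x | forall j, F j (tnth x j)]); last first.
  apply/seteqP; split => x /=; last by move/(_ i); rewrite /F eqxx.
  by move=> xA j; rewrite /F; case: eqVneq => // ->.
rewrite lebesgue_Rspace_box; last by move=> j; rewrite /F; case: ifP.
by rewrite (bigD1 i)//= /F eqxx A0 mul0e.
Qed.

Definition open_box n (a : 'I_n -> R) : set (Rspace R n) :=
  [set x | forall i, `|(tnth x i : R)| < a i].

Definition closed_box n (a : 'I_n -> R) : set (Rspace R n) :=
  [set x | forall i, `|(tnth x i : R)| <= a i].

Lemma measurable_open_box n (a : 'I_n -> R) : measurable (open_box a).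
Proof.
rewrite (_ : open_box a = [set x | forall i, `]- a i, a i[%classic (tnth x i)]).
  exact: (@measurable_box n (fun i => `]- a i, a i[%classic)).
by apply/seteqP; split => y /= ya j; have := ya j; rewrite /= in_itv/= ltr_norml.
Qed.

Lemma measurable_closed_box n (a : 'I_n -> R) : measurable (closed_box a).
Proof.
rewrite (_ : closed_box a = [set x | forall i, `[- a i, a i]%classic (tnth x i)]).
  exact: (@measurable_box n (fun i => `[- a i, a i]%classic)).
by apply/seteqP; split => y /= ya j; have := ya j; rewrite /= in_itv/= ler_norml.
Qed.

(** From a point outside the open box one can move outwards in one coordinate
    and stay in C, so C contains a small box outside the closed box. *)
Lemma box_open_outside n (a : 'I_n -> R) (C : set (Rspace R n)) x :
  box_open C -> C x -> ~ open_box a x ->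
  (0 < lebesgue_Rspace R n (C `\` closed_box a))%E.
Proof.
move=> oC Cx /existsNP[i /negP]; rewrite -leNgt => aix.
have [e e0 eC] := oC _ Cx.
pose I j : set (measurableTypeR R) :=
  if j == i then (if 0 <= (tnth x j : R) then `](tnth x j : R), (tnth x j : R) + e[
     else `](tnth x j : R) - e, (tnth x j : R)[)%classic
  else `](tnth x j : R) - e, (tnth x j : R) + e[%classic.
have mI j : measurable (I j) by rewrite /I; do 2?case: ifP.
have IC : [set y | forall j, I j (tnth y j)] `<=`
    C `\` closed_box a.
  move=> y /= yI; split.
    apply: eC => j; have := yI j; rewrite /I.
    by (do 2?case: ifP => _); rewrite /= in_itv/= => /andP[? ?];
      rewrite ltr_norml; apply/andP; split; lra.
  move=> /(_ i); have := yI i; rewrite /I eqxx.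
  case: ifPn => [x0|/negP x0]; rewrite /= in_itv/= => /andP[? ?].
    by move: aix; rewrite ger0_norm// ler_norml => ? /andP[? ?]; lra.
  move: x0 => /negP; rewrite -ltNge => x0.
  by move: aix; rewrite ltr0_norm// ler_norml => ? /andP[? ?]; lra.
apply: (@lt_le_trans _ _ (lebesgue_Rspace R n [set y | forall j, I j (tnth y j)])).
  rewrite lebesgue_Rspace_box//; apply: (big_ind (fun z => 0 < z)%E) => //.
    by move=> u v u0 v0; rewrite mule_gt0.
  move=> j _; rewrite /I.
  by (do 2?case: ifP => _); rewrite lebesgue_measure_itv/= lte_fin ifT -?EFinD ?lte_fin; lra.
apply: le_measure => //; rewrite inE; first exact: measurable_box.
by apply: measurableD; [exact: box_open_measurable|exact: measurable_closed_box].
Qed.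

End box_topology.

(** * Comparison of the product measures *)

Lemma measurable_eprod d (T : measurableType d) (R : realType) (I : Type)
    (s : seq I) (f : I -> T -> \bar R) :
  (forall i, measurable_fun setT (f i)) ->
  measurable_fun setT (fun x => \prod_(i <- s) f i x)%E.
Proof.
move=> mf; elim: s => [|i s IH].
  by under eq_fun do rewrite big_nil; exact: measurable_cst.
by under eq_fun do rewrite big_cons; exact: emeasurable_funM.
Qed.

(** On the faces of the cube the cosine vanishes, and so does its inverse by
    convention; no null set has to be removed. *)
Lemma secant_measureE (R : realType) n (A : R) (B : set (Rspace R n)) :
  0 < A ->
  secant_measure A B =
  (\int[lebesgue_Rspace R n]_x
    ((\1_B x)%:E * (\prod_(i < n) secant A (tnth x i))%:E))%E.
Proof.
move=> A0; rewrite /secant_measure integral_mkcond; apply: eq_integral => x _.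
rewrite patchE indicE in_setI; case: (x \in B) => /=; last by rewrite mul0e.
rewrite mul1e; case: ifPn => [|/negP].
  rewrite inE /= => xc; congr _%:E; apply: eq_bigr => i _.
  rewrite /secant; case: ifPn => //; rewrite -leNgt => cx.
  suff -> : cos (A * tnth x i) = 0 by rewrite invr0.
  have Ac : A * (pi / (2 * A)) = pi / 2 by field; exact: lt0r_neq0.
  have /andP[cx1 xc1] := xc i.
  have [x0|x0] := leP 0 (tnth x i : R).
    have -> : tnth x i = pi / (2 * A) :> R.
      by apply/eqP; rewrite eq_le xc1 -(ger0_norm x0).
    by rewrite Ac cos_pihalf.
  have -> : tnth x i = - (pi / (2 * A)) :> R.
    by apply/eqP; rewrite eq_le cx1 lerNr -(ltr0_norm x0) cx.
  by rewrite mulrN Ac cosN cos_pihalf.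
rewrite inE /= => /existsNP[i xi]; congr _%:E; rewrite (bigD1 i)//= /secant ifF ?mul0r//.
apply/negbTE/negP => xc; apply: xi.
by move: xc; rewrite ltr_norml => /andP[? ?]; apply/andP; split; exact: ltW.
Qed.

(** Requiring the image to lie in the open box discards the points of the cube
    that are clamped to its boundary. *)
Definition transport_preimage (R : realType) n (A : R) (a : 'I_n -> R)
    (S : 'I_n -> R -> R) (B : set (Rspace R n)) : set (Rspace R n) :=
  [set x | (B `&` open_box a) (coordinatewise S x) /\
           open_box (fun=> pi / (2 * A)) x].

Section product_comparison.
Variables (R : realType) (n : nat) (A : R) (A_gt0 : 0 < A).
Variables (W : 'I_n -> R -> \bar R) (a : 'I_n -> R) (S : 'I_n -> R -> R).
Hypothesis W_convex : forall i, econvex (W i).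
Hypothesis W_ge0 : forall i x, (0 <= W i x)%E.
Hypothesis WS : forall i, secant_transport A (W i) (a i) (S i).

Let L := lebesgue_Rspace R n.
Let D := open_box a.
Let q (x : Rspace R n) : \bar R := (\prod_(i < n) expeR (W i (tnth x i)))%E.
Let T : Rspace R n -> Rspace R n := coordinatewise S.

Let measurable_q : measurable_fun setT q.
Proof.
apply: (@measurable_eprod _ _ _ _ _ (fun i x => expeR (W i (tnth x i)))) => i.
have mW := measurable_expeR_convex (W_convex i) (W_ge0 i).
exact: (measurableT_comp mW (measurable_tnth i)).
Qed.

Let q_ge0 x : (0 <= q x)%E.
Proof. by apply: prode_ge0 => i _; exact: expeR_ge0. Qed.

Let measurable_T : measurable_fun setT T.
Proof.
by apply: measurable_coordinatewise => i; apply: lip_measurable; exact: transport_lip (WS i).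
Qed.

Let mD : measurable D. Proof. exact: measurable_open_box. Qed.

Let q_inside x : D x -> q x = (\prod_(i < n) exp_inside (W i) (a i) (tnth x i))%:E.
Proof.
move=> Dx; rewrite /q -prodEFin; apply: eq_bigr => i _.
by rewrite /exp_inside (Dx i) -[in LHS](fineK (transport_finite (WS i) (Dx i))).
Qed.

(** One factor is +oo and, W being nonnegative, none of them vanishes. *)
Let q_outside x : ~ closed_box a x -> q x = +oo%E.
Proof.
move=> /existsNP[i /negP]; rewrite -ltNge => xi.
rewrite /q (bigD1 i)//= (transport_infinite (WS i) xi) gt0_mulye//.
apply: (big_ind (fun z => 0 < z)%E) => // [u v u0 v0|j _]; first exact: mule_gt0.
by rewrite expeR_gt0// (lt_le_trans _ (W_ge0 _ _)).
Qed.

Let potentialE B : potential_measure W B = (\int[L]_(x in B) q x)%E.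
Proof. by []. Qed.

Let potential_outside B : measurable B -> (0 < L (B `\` closed_box a))%E ->
  potential_measure W B = +oo%E.
Proof.
move=> mB LB; have mBa : measurable (B `\` closed_box a).
  by apply: measurableD => //; exact: measurable_closed_box.
apply/eqP; rewrite -leye_eq potentialE.
rewrite (@le_trans _ _ (\int[L]_(x in B `\` closed_box a) q x)%E)//; last first.
  apply: ge0_subset_integral => //; exact: measurable_funTS.
rewrite (eq_integral (cst +oo%E)); last first.
  by move=> x; rewrite inE => -[_ xa]; exact: q_outside.
by rewrite integral_cst// gt0_mulye.
Qed.

Let boundary_null : L (closed_box a `\` D) = 0%E.
Proof.
pose F i : set (Rspace R n) := [set x | [set - a i; a i] (tnth x i)].
have mF i : measurable (F i).
  have : measurable [set - a i; a i] by exact: measurableU.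
  move=> /(@measurable_tnth _ (measurableTypeR R) n i measurableT).
  by rewrite setTI.
have F0 i : L (F i) = 0%E.
  apply: (@lebesgue_Rspace_coord_null R n i [set - a i; a i]).
    exact: measurableU.
  apply: countable_lebesgue_measure0; apply: finite_set_countable.
  exact: finite_set2.
apply/eqP; rewrite eq_le measure_ge0 andbT.
have DF : closed_box a `\` D `<=` \bigcup_(i in [set: 'I_n]) F i.
  move=> x [xa /existsNP[i /negP]]; rewrite -leNgt => ax; exists i => //=.
  have : `|(tnth x i : R)| = a i by apply/eqP; rewrite eq_le ax xa.
  rewrite /F/=; have [x0 <-|x0 <-] := ger0P (tnth x i : R); first by right.
  by left; rewrite opprK.
apply: le_trans (content_sub_fsum L _ _ _ DF) _ => //.
- exact: finite_finset.
- by apply: measurableD => //; exact: measurable_closed_box.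
- by rewrite fsbig1 => [|i _]; [exact: lexx|exact: F0].
Qed.

(** A set of finite measure is, up to a null set, contained in the open box. *)
Let potential_inside B t : measurable B -> potential_measure W B = t%:E ->
  potential_measure W (B `&` D) = t%:E.
Proof.
move=> mB Bt; rewrite -Bt !potentialE.
have BD : B = (B `&` D) `|` (B `\` D) by rewrite setUIDK.
rewrite [in RHS]BD ge0_integral_setU//; last 4 first.
- exact: measurableI.
- exact: measurableD.
- exact: measurable_funTS.
- rewrite disj_set2E; apply/eqP/seteqP; split => x //= -[[_ Dx] [_]]; exact.
rewrite (null_set_integral (N := B `\` D)) ?adde0//.
- exact: measurableD.
- exact: measurable_funTS.
apply/eqP; rewrite eq_le measure_ge0 andbT.
rewrite (@le_trans _ _ (L ((B `\` closed_box a) `|` (closed_box a `\` D))))//.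
  apply: le_measure; rewrite ?inE.
  - exact: measurableD.
  - apply: measurableU; apply: measurableD => //; exact: measurable_closed_box.
  - move=> x [Bx Dx]; have [xa|xa] := pselect (closed_box a x); [right|left]; by [].
apply: (le_trans (measureU2 _ _ _)).
- by apply: measurableD => //; exact: measurable_closed_box.
- by apply: measurableD => //; exact: measurable_closed_box.
rewrite [X in (_ + X <= _)%E](_ : _ = 0%E); last exact: boundary_null.
rewrite adde0 leNgt; apply/negP => /(potential_outside mB).
by rewrite Bt.
Qed.

Let gpre (x : Rspace R n) : R :=
  \prod_(i < n) secant_pre A (a i) (S i) (tnth x i).

Let transferred B : measurable B ->
  potential_measure W (B `&` D) = (\int[L]_x ((\1_(B `&` D) (T x))%:E * (gpre x)%:E))%E.
Proof.
move=> mB; have mBD : measurable (B `&` D) by exact: measurableI.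
rewrite (integral_coordinatewise (g := fun i => secant_pre A (a i) (S i))
  (h := fun i => exp_inside (W i) (a i)) _ _ _ _ _ _
  (f := fun x => (\1_(B `&` D) x)%:E)).
- rewrite potentialE integral_mkcond; apply: eq_integral => x _.
  rewrite patchE indicE; case: ifPn => [|_]; last by rewrite mul0e.
  by rewrite inE mul1e => -[_]; exact: q_inside.
- by move=> i; apply: lip_measurable; exact: transport_lip (WS i).
- move=> i; apply: measurable_secant_pre => //.
  by apply: lip_measurable; exact: transport_lip (WS i).
- by move=> i; exact: measurable_exp_inside.
- by move=> i x; exact: secant_pre_ge0.
- by move=> i x; exact: exp_inside_ge0.
- by move=> i; exact: transport_integral (WS i).
- by apply/measurable_EFinP; exact: measurable_indic.
- by move=> x; rewrite lee_fin.
Qed.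

Let preB := transport_preimage A a S.

Let gpreE x : D (T x) -> gpre x = \prod_(i < n) secant A (tnth x i).
Proof.
move=> DTx; apply: eq_bigr => i _; rewrite /secant_pre.
by have := DTx i; rewrite tnth_mktuple => ->.
Qed.

Let secant_out x : ~ open_box (fun=> pi / (2 * A)) x ->
  \prod_(i < n) secant A (tnth x i) = 0.
Proof.
move=> /existsNP[i /negP xi].
by rewrite (bigD1 i)//= /secant (negbTE xi) mul0r.
Qed.

Lemma measurable_transport_preimage B : measurable B -> measurable (preB B).
Proof.
move=> mB; apply: measurableI; last exact: measurable_open_box.
rewrite -[X in measurable X]setTI; apply: measurable_T => //.
exact: measurableI.
Qed.

Lemma secant_transport_preimage B t : measurable B -> potential_measure W B = t%:E ->
  secant_measure A (preB B) = t%:E.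
Proof.
move=> mB /(potential_inside mB) <-; rewrite transferred// secant_measureE//.
apply: eq_integral => x _; rewrite !indicE.
have [TB|TB] := pselect ((B `&` D) (T x)); last first.
  by rewrite [in RHS]memNset// memNset ?mul0e// => -[].
rewrite [in RHS]mem_set// gpreE; last by case: TB.
have [xc|xc] := pselect (open_box (fun=> pi / (2 * A)) x).
  by rewrite mem_set.
by rewrite secant_out// !mule0.
Qed.

(** The heart of the comparison: the image of a neighbourhood under the
    1-Lipschitz map is contained in the neighbourhood of the image, unless
    the latter has infinite measure. *)
Lemma secant_transport_preimage_neigh B e : measurable B ->
  (secant_measure A (eneigh e (preB B)) <= potential_measure W (eneigh e B))%E.
Proof.
move=> mB; pose C := eneigh e (B `&` D).
have mC : measurable C by exact: measurable_eneigh.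
have CB : C `<=` eneigh e B by move=> x [y [By _] xy]; exists y.
apply: (@le_trans _ _ (potential_measure W C)); last first.
  rewrite !potentialE; apply: ge0_subset_integral => //.
  - exact: measurable_eneigh.
  - exact: measurable_funTS.
have [CD|] := pselect (C `<=` D); last first.
  move=> /existsNP[x /not_implyP[Cx Dx]].
  rewrite potential_outside ?leey//.
  by apply: box_open_outside Cx Dx; exact: eneigh_box_open.
have <- : C `&` D = C by exact/setIidPl.
rewrite transferred// secant_measureE//; apply: ge0_le_integral => //.
- by move=> x _; rewrite mule_ge0// lee_fin ?prodr_ge0// => i _; exact: secant_ge0.
- apply: emeasurable_funM; apply/measurable_EFinP.
    by apply: measurable_indic; exact: measurable_eneigh.
  by apply: (@measurable_prod_tnth R n (fun=> secant A)) => i; exact: measurable_secant.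
- apply: emeasurable_funM; apply/measurable_EFinP.
    apply: measurableT_comp measurable_T; apply: measurable_indic.
    exact: measurableI.
  apply: (@measurable_prod_tnth R n (fun i => secant_pre A (a i) (S i))) => i.
  apply: measurable_secant_pre => //.
  by apply: lip_measurable; exact: transport_lip (WS i).
move=> x _.
have g0 : 0 <= gpre x by apply: prodr_ge0 => i _; exact: secant_pre_ge0.
rewrite indicE; have [|_] := boolP (x \in _); last first.
  by rewrite mul0e mule_ge0// lee_fin.
rewrite inE => -[y [[By Dy] yc] xy]; rewrite mul1e.
have CTx : C (T x).
  exists (T y) => //; apply: le_lt_trans xy; apply: edist_coordinatewise => i.
  exact: transport_lip (WS i).
by rewrite indicE mem_set ?mul1e ?gpreE//; [exact: CD|split => //; exact: CD].
Qed.

End product_comparison.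

(** * The isoperimetric functions *)

(** Only the points to the right of x matter, so f <= g may fail elsewhere. *)
Lemma le_limf_einf_at_right (R : realType) (f g : R -> \bar R) (x : R) :
  (forall e, x < e -> (f e <= g e)%E) ->
  (limf_einf f x^'+ <= limf_einf g x^'+)%E.
Proof.
move=> fg; rewrite !limf_einfE; apply: ge_ereal_sup => _ [V xV <-].
apply: (@le_trans _ _ (ereal_inf (g @` (V `&` [set e | x < e])))); last first.
  apply: ereal_sup_ubound; exists (V `&` [set e | x < e]) => //.
  by apply: filterI => //; exact: nbhs_right_gt.
apply: le_ereal_inf_tmp => _ [e [Ve xe] <-]; apply: le_trans (fg _ xe).
by apply: ereal_inf_lbound; exists e.
Qed.

(** With equal measures, the difference quotients are ordered as soon as the
    measures of the neighbourhoods are. *)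
Lemma le_surface_measure (R : realType) n (mu nu : set (Rspace R n) -> \bar R)
    (B C : set (Rspace R n)) :
  mu B = nu C ->
  (forall e, 0 < e -> (mu (eneigh e B) <= nu (eneigh e C))%E) ->
  (surface_measure mu B <= surface_measure nu C)%E.
Proof.
move=> BC le_mu_nu; apply: le_limf_einf_at_right => e e0.
rewrite BC lee_wpmul2r ?lee_fin ?invr_ge0 ?(ltW e0)//.
by rewrite leeD2r// le_mu_nu.
Qed.

Lemma isoperimetric_le_of_transport (R : realType) n (A : R)
    (W : 'I_n -> R -> \bar R) (a : 'I_n -> R) (S : 'I_n -> R -> R) :
  0 < A -> (forall i, econvex (W i)) -> (forall i x, (0 <= W i x)%E) ->
  (forall i, secant_transport A (W i) (a i) (S i)) ->
  forall t, (isoperimetric_function (@secant_measure R n A) t <=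
             isoperimetric_function (potential_measure W) t)%E.
Proof.
move=> A0 cW W0 WS t; apply: le_ereal_inf_tmp => _ [B [mB Bt] <-].
apply: (@le_trans _ _ (surface_measure (@secant_measure R n A)
    (transport_preimage A a S B))).
  apply: ereal_inf_lbound; exists (transport_preimage A a S B) => //; split.
    exact: measurable_transport_preimage WS _ mB.
  exact: (secant_transport_preimage A0 cW W0 WS).
apply: le_surface_measure => [|e _].
  by rewrite Bt (secant_transport_preimage A0 cW W0 WS mB Bt).
exact: (secant_transport_preimage_neigh A0 cW W0 WS).
Qed.

Unset Implicit Arguments.

(* W_i'' is the ordinary second derivative, taken in the interior of the domain
   where W_i is finite *)
Theorem corollary6p14 (R : realType) (d : nat) (d_gt0 : (0 < d)%N)
  (A : R) (A_gt0 : 0 < A) (W : 'I_d -> R -> \bar R)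
  (W_neqNy : forall i x, W i x != -oo%E)
  (W_convex : forall i, econvex (W i))
  (W_even : forall i x, W i (- x) = W i x)
  (W0 : forall i, W i 0 = 0%E)
  (W_ineq : forall i (x : R), (interior [set y : R | W i y \is a fin_num]) x ->
    [/\ derivable (fine \o W i) x 1,
        derivable (derive1 (fine \o W i)) x 1 &
        A ^+ 2 <= derive1n 2 (fine \o W i) x * expR (- 2 * fine (W i x))]) :
  forall t : R, 0 <= t ->
    (isoperimetric_function (@secant_measure R d A) t <=
     isoperimetric_function (potential_measure W) t)%E.
Proof.
move=> t _.
have transports i := exists_secant_transport A_gt0 (W_neqNy i) (W_convex i)
  (W_even i) (W0 i) (W_ineq i).
have [a aS] := choice transports; have [S WS] := choice aS.
apply: isoperimetric_le_of_transport WS t => // i x.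
exact: even_econvex_ge0.
Qed.
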